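(* If a Banach space $X$ does not have the Radon-Nikodým property, then there exist Banach spaces $X_1$ and $X_2$, both isomorphic to $X$, such that $\mathrm{QNA}(X_1,X_2)$ is not dense in $\mathcal{L}(X_1,X_2)$.
   Context: Banach spaces are over $\mathbb{K}=\mathbb{R}$ or $\mathbb{C}$; isomorphic means linearly homeomorphic; $B_X$ is the closed unit ball of $X$; $\mathcal{L}(X,Y)$ is the space of bounded linear operators with the operator norm. $T\in\mathcal{L}(X,Y)$ is quasi norm attaining, $T\in\mathrm{QNA}(X,Y)$, if there is $u\in\overline{T(B_X)}$ (norm closure) with $\|u\|=\|T\|$. A Banach space has the Radon-Nikodým property (RNP) if every nonempty bounded subset of it is dentable, where a set $A$ is dentable if for every $\delta>0$ there is $a\in A$ not belonging to the closed convex hull of $A\setminus\{b:\|b-a\|<\delta\}$. *)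

(* Defs.v *)
From HB Require Import structures.
From mathcomp Require Import all_boot all_order all_algebra.
From mathcomp Require Import all_classical all_reals all_analysis.
From mathcomp Require Import complex.

Set Implicit Arguments.
Unset Strict Implicit.
Unset Printing Implicit Defensive.

Import Order.TTheory GRing.Theory Num.Theory.
Import numFieldNormedType.Exports.

Local Open Scope classical_set_scope.
Local Open Scope ring_scope.

(* Everything is stated over [K : numFieldType] so that it applies both to
   [R : realType] and to the complex field [R[i]]. Norms take their values in
   [K]; in [R[i]], [x <= y] means that [y - x] is a nonnegative real, so
   nonnegative elements (norms, radii, weights of convex combinations) are
   real. *)

Definition convex_hull (K : numFieldType) (X : normedModType K) (A : set X) :
    set X :=
  smallest (@convex_set K X) A.

Definition dentable (K : numFieldType) (X : normedModType K) (A : set X) :=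
  forall delta : K, 0 < delta ->
    exists2 a, A a &
      ~ closure (convex_hull (A `\` [set b | `|b - a| < delta])) a.

Definition radon_nikodym (K : numFieldType) (X : normedModType K) :=
  forall A : set X, A !=set0 -> bounded_set A -> dentable A.

Definition isomorphic (K : numFieldType) (X Y : normedModType K) :=
  exists (f : {linear X -> Y}) (g : Y -> X),
    [/\ cancel f g, cancel g f, continuous f & continuous g].

Definition unit_ball (K : numFieldType) (X : normedModType K) : set X :=
  [set x | `|x| <= 1].
Arguments unit_ball {K} X.

Definition bounded_operators (K : numFieldType) (X Y : normedModType K) :
    set {linear X -> Y} :=
  [set T | [bounded T x | x in unit_ball X]].
Arguments bounded_operators {K} X Y.

(* [supremum] is the least upper bound for the order of [K]; over [R] and
   [R[i]] it exists for every bounded operator (the default [0] is not used),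
   see [opnorm_lub_real] and [opnorm_lub_complex]. *)
Definition opnorm (K : numFieldType) (X Y : normedModType K) (T : X -> Y) : K :=
  supremum 0 [set `|T x| | x in unit_ball X].

Definition QNA (K : numFieldType) (X Y : normedModType K) :
    set {linear X -> Y} :=
  [set T | bounded_operators X Y T /\
    exists2 u, closure (T @` unit_ball X) u & `|u| = opnorm T].
Arguments QNA {K} X Y.

Definition opnorm_dense (K : numFieldType) (X Y : normedModType K)
    (D : set {linear X -> Y}) :=
  forall T, bounded_operators X Y T -> forall e : K, 0 < e ->
    exists2 S, D S & opnorm (T \- S) < e.

Lemma opnorm_lub (K : numFieldType) (X Y : normedModType K) (T : X -> Y) (c : K) :
  isLub [set `|T x| | x in unit_ball X] c ->
  isLub [set `|T x| | x in unit_ball X] (opnorm T).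
Proof.
move=> lubc; rewrite /opnorm /supremum ifF; last first.
  apply/negbTE/set0P; exists `|T 0|; exists 0 => //.
  by rewrite /unit_ball /= normr0.
by case: xgetP => [_ -> //|/(_ c)] [].
Qed.

Lemma bounded_operators_bound (K : numFieldType) (X Y : normedModType K)
    (T : {linear X -> Y}) :
  bounded_operators X Y T -> exists M, ubound [set `|T x| | x in unit_ball X] M.
Proof.
have ball0 : unit_ball X 0 by rewrite /unit_ball /= normr0.
move=> /(@ex_bound _ _ _ _ _ (globally_properfilter ball0))[M TM].
by exists M => _ [x x1 <-]; exact: TM.
Qed.

Lemma opnorm_lub_real (R : realType) (X Y : normedModType R)
    (T : {linear X -> Y}) :
  bounded_operators X Y T ->
  isLub [set `|T x| | x in unit_ball X] (opnorm T).
Proof.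
case/bounded_operators_bound => M TM.
set A := (X in isLub X _).
have A0 : A !=set0.
  by exists `|T 0|; exists 0 => //; rewrite /unit_ball /= normr0.
apply: (@opnorm_lub _ _ _ _ (sup A)); split.
  by apply: sup_upper_bound; split => //; exists M.
by move=> b; exact: ge_sup.
Qed.

Lemma opnorm_lub_complex (R : realType) (X Y : normedModType R[i])
    (T : {linear X -> Y}) :
  bounded_operators X Y T ->
  isLub [set `|T x| | x in unit_ball X] (opnorm T).
Proof.
case/bounded_operators_bound => M TM.
set A := (X in isLub X _).
have Im0 a : A a -> complex.Im a = 0.
  by case=> x _ <-; have := normr_ge0 (T x); rewrite lecE => /andP[/eqP].
have A0 : A `|T 0| by exists 0 => //; rewrite /unit_ball /= normr0.
pose B := [set complex.Re a | a in A].
have supB : has_sup B.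
  split; first by exists (complex.Re `|T 0|), `|T 0|.
  by exists (complex.Re M) => _ [a Aa <-]; have := TM a Aa; rewrite lecE => /andP[].
apply: (@opnorm_lub _ _ _ _ (Complex (sup B) 0)); split => [a Aa|b Ab].
  rewrite lecE (Im0 _ Aa) eqxx /=.
  by apply: sup_upper_bound => //; exists a.
have := Ab _ A0; rewrite lecE (Im0 _ A0) => /andP[/eqP Imb _].
rewrite lecE /= Imb eqxx /=; apply: ge_sup; first by case: supB.
by move=> _ [a Aa <-]; have := Ab a Aa; rewrite lecE => /andP[].
Qed.

(* Main.v *)
Require Import Defs.
From HB Require Import structures.
From mathcomp Require Import all_boot all_order all_algebra.
From mathcomp Require Import all_classical all_reals all_analysis.
From mathcomp Require Import complex.
From mathcomp Require Import ring lra.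

Set Implicit Arguments.
Unset Strict Implicit.
Unset Printing Implicit Defensive.

Import Order.TTheory GRing.Theory Num.Theory.
Import numFieldNormedType.Exports.

Local Open Scope classical_set_scope.
Local Open Scope ring_scope.
Local Open Scope complex_scope.

(* If [X] fails the RNP, there are a bounded sequence [a] and [d > 0] such that
   every [a n] is in the closed convex hull of the terms at distance at least [d]
   from it. A superlemma argument strengthens this: these hulls are not changed by
   removing from the sequence a small neighbourhood of a totally bounded set. Let
   [C_k] be the convex circled hull of [a 0, ..., a k], [C] the union of the [C_k],
   [q_k] and [q] the gauges of [C_k + r B] and [C + r B] with [r] much smaller than
   [d], and [N := sum_k 2^-(k+1) q_k]. Take [X_1 = (X, q)], [X_2 = (X, N)].
   Let [S] be close to the identity and suppose that [u], in the closure of the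
   image of the unit ball, has [N u = |S|]. Since [q_k u] tends to [q u], some [k]
   has [q_k u] barely above 1, whereas [q_k (S (x + y))] is larger by a fixed amount
   when [|y| <= r] and [x] in [C] is far from [C_k]. As [N <= |S|] at those
   points, the seminorm [N - 2^-(k+1) q_k] is there at most
   [|S| - 2^-(k+1) (q_k u + theta)]. This bound passes to convex combinations, and
   the points of [C] far from [C_k] have [C] in their closed convex hull; so it
   holds on the image of the unit ball, hence at [u], where it gives [N u < |S|]. *)

Lemma closure_norm (K : numFieldType) (V : normedModType K) (A : set V) (a : V) :
  closure A a <-> forall e : K, 0 < e -> exists2 b, A b & `|a - b| < e.
Proof.
split=> [clA e e0|clA B /nbhs_ballP[e /= e0 eB]].
  have [b [Ab]] := clA (ball a e) (nbhsx_ballx a e e0).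
  by rewrite -ball_normE /= => ?; exists b.
have [b Ab ab] := clA e e0; exists b; split=> //; apply: eB.
by rewrite -ball_normE.
Qed.

(** * Convexity over the real scalars *)

(* [emb] and [re] treat [K = R] and [K = R[i]] at once: [emb] embeds the reals in
   [K] and [re] inverts it on nonnegative elements, so that [rnorm] is the norm with
   values in [R], where infima and suprema exist. *)
Section RealScalars.
Context (R : realType) (K : numFieldType) (emb : {rmorphism R -> K}) (re : K -> R).
Hypothesis emb_le : {mono emb : x y / x <= y}.
Hypothesis reK : forall z, 0 <= z -> emb (re z) = z.

Lemma emb_inj : injective emb.
Proof. exact: (inc_inj emb_le). Qed.

Lemma emb_lt : {mono emb : x y / x < y}.
Proof. exact: (leW_mono emb_le). Qed.

Lemma emb_ge0 a : (0 <= emb a) = (0 <= a).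
Proof. by rewrite -{1}(rmorph0 emb) emb_le. Qed.

Lemma emb_gt0 a : (0 < emb a) = (0 < a).
Proof. by rewrite -{1}(rmorph0 emb) emb_lt. Qed.

Lemma embK a : 0 <= a -> re (emb a) = a.
Proof. by move=> a0; apply: emb_inj; rewrite reK // emb_ge0. Qed.

Definition rnorm (V : normedZmodType K) (x : V) : R := re `|x|.

Lemma embn (V : normedZmodType K) (x : V) : emb (rnorm x) = `|x|.
Proof. exact: reK. Qed.

Lemma rnorm_ge0 (V : normedZmodType K) (x : V) : 0 <= rnorm x.
Proof. by rewrite -emb_ge0 embn. Qed.

Lemma rnorm0 (V : normedZmodType K) : rnorm (0 : V) = 0.
Proof. by apply: emb_inj; rewrite embn normr0 rmorph0. Qed.

Lemma rnormN (V : normedZmodType K) (x : V) : rnorm (- x) = rnorm x.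
Proof. by rewrite /rnorm normrN. Qed.

Lemma rnormB (V : normedZmodType K) (x y : V) : rnorm (x - y) = rnorm (y - x).
Proof. by rewrite /rnorm distrC. Qed.

Lemma rnormD (V : normedZmodType K) (x y : V) : rnorm (x + y) <= rnorm x + rnorm y.
Proof. by rewrite -emb_le rmorphD /= !embn ler_normD. Qed.

Lemma rnorm_dist (V : normedZmodType K) (x y z : V) :
  rnorm (x - z) <= rnorm (x - y) + rnorm (y - z).
Proof. by apply: le_trans (rnormD _ _); rewrite addrA subrK. Qed.

Lemma rnorm1 : rnorm (1 : K) = 1.
Proof. by apply: emb_inj; rewrite embn normr1 rmorph1. Qed.

Lemma rnorm_gt0 (V : normedZmodType K) (x : V) : x != 0 -> 0 < rnorm x.
Proof. by move=> x0; rewrite -emb_gt0 embn normr_gt0. Qed.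

Lemma rnorm_emb (a : R) : 0 <= a -> rnorm (emb a) = a.
Proof. by move=> a0; apply: emb_inj; rewrite embn ger0_norm // emb_ge0. Qed.

Section Convexity.
Variable X : normedModType K.
Implicit Types (x y z : X) (A W : set X) (f p : X -> R).

Lemma rnormZ (k : K) x : rnorm (k *: x) = rnorm k * rnorm x.
Proof. by apply: emb_inj; rewrite rmorphM /= !embn normrZ. Qed.

Lemma closure_rnorm A x :
  closure A x <-> forall e : R, 0 < e -> exists2 y, A y & rnorm (x - y) < e.
Proof.
rewrite closure_norm; split=> clA e e0.
  have [|y Ay ye] := clA (emb e); first by rewrite emb_gt0.
  by exists y => //; rewrite -emb_lt embn.
have [|y Ay ye] := clA (re e); first by rewrite -emb_gt0 reK // ltW.
by exists y => //; rewrite -embn -(reK (ltW e0)) emb_lt.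
Qed.

Definition rconvex W := forall x y (s t : R), 0 <= s -> 0 <= t -> s + t = 1 ->
  W x -> W y -> W (emb s *: x + emb t *: y).

Definition convexf f := forall x y (s t : R), 0 <= s -> 0 <= t -> s + t = 1 ->
  f (emb s *: x + emb t *: y) <= s * f x + t * f y.

Definition lipschitzf f := exists2 L : R, 0 <= L &
  forall x y, f x <= f y + L * rnorm (x - y).

(** The weights of [convex_set] are elements of [K] between 0 and 1; being nonnegative, they are
    images under [emb] of real weights. *)
Lemma rconvexP W : @convex_set K X W <-> rconvex W.
Proof.
split=> [cW x y s t s0 t0 st Wx Wy|cW x y l].
  have s1 : (0 <= emb s <= 1)%R.
    by rewrite emb_ge0 s0 -(rmorph1 emb) emb_le -st lerDl.
  have /set_mem := cW x y (Itv01 (proj1 (andP s1)) (proj2 (andP s1))) (mem_set Wx) (mem_set Wy).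
  have -> // : emb t = 1 - emb s.
  by rewrite -(rmorph1 emb) -rmorphB -st addrAC subrr add0r.
rewrite !inE => Wx Wy.
have l0 : 0 <= l%:num by [].
have l1 : l%:num <= 1 by [].
have el : emb (1 - re l%:num) = 1 - l%:num.
  by rewrite rmorphB /= reK // rmorph1.
have : W (emb (re l%:num) *: x + emb (1 - re l%:num) *: y).
  apply: cW => //; last by rewrite addrC subrK.
    by rewrite -emb_ge0 reK.
  by rewrite -emb_ge0 el subr_ge0.
by rewrite el reK.
Qed.

Lemma convex_hull_sub A W : rconvex W -> A `<=` W -> convex_hull A `<=` W.
Proof. by move=> /rconvexP cW AW; apply: smallest_sub. Qed.

Lemma sub_convex_hull A : A `<=` convex_hull A.
Proof. exact: sub_gen_smallest. Qed.

Lemma convex_hull_convex A : rconvex (convex_hull A).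
Proof.
move=> x y s t s0 t0 st hx hy W [cW AW].
have /rconvexP cW' := cW.
by apply: cW' => //; [exact: hx | exact: hy].
Qed.

Lemma convex_hullS A W : A `<=` W -> convex_hull A `<=` convex_hull W.
Proof.
move=> AW; apply: convex_hull_sub; first exact: convex_hull_convex.
by apply: subset_trans AW _; exact: sub_convex_hull.
Qed.

Lemma convex_hull0 : convex_hull (set0 : set X) = set0.
Proof.
by apply/seteqP; split=> //; apply: convex_hull_sub.
Qed.

Lemma sublevel_convex f (s : R) : convexf f -> rconvex [set x | f x <= s].
Proof.
move=> cf x y a b a0 b0 ab /= fx fy; apply: le_trans (cf _ _ _ _ a0 b0 ab) _.
by rewrite -[leRHS]mul1r -ab mulrDl lerD // ler_wpM2l.
Qed.

(** The sublevel sets of [f] are convex, and the Lipschitz bound carries the estimate to the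
    closure. Estimates pass to closed convex hulls through this lemma. *)
Lemma closure_hull_le f A (s : R) x : convexf f -> lipschitzf f ->
  (forall y, A y -> f y <= s) -> closure (convex_hull A) x -> f x <= s.
Proof.
move=> cf [L L0 lf] fA /closure_rnorm clx; apply/ler_addgt0Pr => e e0.
(* [L] itself may be 0 and could not serve as a divisor. *)
have L1 : 0 < L + 1 by rewrite ltr_wpDl.
have [|y hy xy] := clx (e / (L + 1)); first by rewrite divr_gt0.
have fy : f y <= s by apply: (convex_hull_sub (sublevel_convex (s := s) cf)) hy.
apply: le_trans (lf x y) _; apply: lerD => //.
move: xy; rewrite ltr_pdivlMr // => /ltW; apply: le_trans.
by rewrite mulrC ler_wpM2l ?rnorm_ge0 // lerDl.
Qed.

Definition seminorm p := (forall x y, p (x + y) <= p x + p y) /\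
  (forall (k : K) x, p (k *: x) = rnorm k * p x).

(** The homogeneity inequality for the inverse of [k] is the converse of the one for [k]. *)
Lemma seminorm_le p : (forall x y, p (x + y) <= p x + p y) ->
  (forall (k : K) x, k != 0 -> p (k *: x) <= rnorm k * p x) ->
  p 0 = 0 -> seminorm p.
Proof.
move=> pD pZ p0; split=> // k x; have [->|k0] := eqVneq k 0.
  by rewrite scale0r rnorm0 mul0r.
apply/eqP; rewrite eq_le pZ //= -ler_pdivlMl ?rnorm_gt0 //.
have -> : (rnorm k)^-1 = rnorm k^-1.
  by apply: emb_inj; rewrite fmorphV /= !embn normfV.
by rewrite -[X in p X <= _](scalerK k0) pZ // invr_eq0.
Qed.

Lemma rnorm_seminorm : seminorm (@rnorm X).
Proof. by split=> [x y|k x]; [exact: rnormD | exact: rnormZ]. Qed.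

Section Seminorm.
Variables (p : X -> R) (sp : seminorm p).

Lemma seminorm0 : p 0 = 0.
Proof. by rewrite -(scale0r (0 : X)) (proj2 sp) rnorm0 mul0r. Qed.

Lemma seminormN x : p (- x) = p x.
Proof. by rewrite -scaleN1r (proj2 sp) rnormN rnorm1 mul1r. Qed.

Lemma seminormB x y : p (x - y) = p (y - x).
Proof. by rewrite -seminormN opprB. Qed.

Lemma seminorm_ge0 x : 0 <= p x.
Proof.
have := proj1 sp x (- x); rewrite subrr seminorm0 seminormN => h.
lra.
Qed.

Lemma seminorm_dist x y : p x <= p y + p (x - y).
Proof. by rewrite -{1}(subrK y x) addrC; exact: (proj1 sp). Qed.

Lemma seminormZ (a : R) x : 0 <= a -> p (emb a *: x) = a * p x.
Proof. by move=> a0; rewrite (proj2 sp) rnorm_emb. Qed.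

Lemma seminorm_convex : convexf p.
Proof.
by move=> x y s t s0 t0 _; apply: le_trans (proj1 sp _ _) _; rewrite !seminormZ.
Qed.

Lemma seminorm_convex_shift z : convexf (fun x => p (x - z)).
Proof.
move=> x y s t s0 t0 st; apply: le_trans (seminorm_convex _ _ s0 t0 st).
rewrite {1}(_ : z = emb s *: z + emb t *: z).
  by rewrite opprD addrACA -!scalerBr.
by rewrite -scalerDl -rmorphD st rmorph1 scale1r.
Qed.

End Seminorm.

Lemma convexfD f g : convexf f -> convexf g -> convexf (f \+ g).
Proof.
move=> cf cg x y s t s0 t0 st /=; rewrite !mulrDr addrACA lerD //.
  exact: cf.
exact: cg.
Qed.

Lemma convexfZ (a : R) f : 0 <= a -> convexf f -> convexf (fun x => a * f x).
Proof.
move=> a0 cf x y s t s0 t0 st /=; rewrite [s * _]mulrCA [t * _]mulrCA -mulrDr.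
by rewrite ler_wpM2l // cf.
Qed.

Lemma lipschitzfD f g : lipschitzf f -> lipschitzf g -> lipschitzf (f \+ g).
Proof.
move=> [L L0 lf] [M M0 lg]; exists (L + M); first exact: addr_ge0.
by move=> x y /=; rewrite mulrDl addrACA lerD.
Qed.

Lemma lipschitzfZ (a : R) f : 0 <= a -> lipschitzf f -> lipschitzf (fun x => a * f x).
Proof.
move=> a0 [L L0 lf]; exists (a * L); first exact: mulr_ge0.
by move=> x y; rewrite -mulrA -mulrDr ler_wpM2l.
Qed.

Lemma rnorm_lipschitz z : lipschitzf (fun x => rnorm (x - z)).
Proof.
by exists 1 => // x y; rewrite mul1r [leRHS]addrC; exact: rnorm_dist.
Qed.

(** * Distance to a set *)

Definition rdist W x : R := inf [set rnorm (x - y) | y in W].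

Section Distance.
Variable W : set X.
Hypothesis W0 : W !=set0.

Lemma rdist_le x y : W y -> rdist W x <= rnorm (x - y).
Proof.
move=> Wy; apply: ge_inf; last by exists y.
by exists 0 => _ [z _ <-]; exact: rnorm_ge0.
Qed.

Lemma rdist_lt x (t : R) : rdist W x < t -> exists2 y, W y & rnorm (x - y) < t.
Proof.
move=> xt; have hi : has_inf [set rnorm (x - y) | y in W].
  split; first by case: W0 => y Wy; exists (rnorm (x - y)), y.
  by exists 0 => _ [z _ <-]; exact: rnorm_ge0.
have [|_ [y Wy <-]] := inf_adherent (_ : 0 < t - rdist W x) hi.
  by rewrite subr_gt0.
by rewrite -/(rdist W x) [ltRHS]addrC subrK => ?; exists y.
Qed.

Lemma rdist_ge0 x : 0 <= rdist W x.
Proof.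
rewrite leNgt; apply/negP => /rdist_lt[y _].
by rewrite ltNge rnorm_ge0.
Qed.

Lemma rdist_in x : W x -> rdist W x = 0.
Proof.
move=> Wx; apply/eqP; rewrite eq_le rdist_ge0 andbT.
by apply: le_trans (rdist_le x Wx) _; rewrite subrr rnorm0.
Qed.

Lemma rdist_closure x : rdist W x <= 0 -> closure W x.
Proof.
by move=> x0; apply/closure_rnorm => e e0; apply: rdist_lt; exact: le_lt_trans e0.
Qed.

Lemma rdist_lipschitz : lipschitzf (rdist W).
Proof.
exists 1 => // x y; rewrite mul1r; apply/ler_addgt0Pr => e e0.
have [|z Wz yz] := @rdist_lt y (rdist W y + e); first by rewrite ltrDl.
apply: le_trans (rdist_le x Wz) _; apply: le_trans (rnorm_dist x y z) _.
by rewrite addrC addrAC lerD2r ltW.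
Qed.

Lemma rdist_convex : rconvex W -> convexf (rdist W).
Proof.
move=> cW x y s t s0 t0 st; apply/ler_addgt0Pr => e e0.
have [|u Wu xu] := @rdist_lt x (rdist W x + e); first by rewrite ltrDl.
have [|v Wv yv] := @rdist_lt y (rdist W y + e); first by rewrite ltrDl.
apply: le_trans (rdist_le _ (cW _ _ _ _ s0 t0 st Wu Wv)) _.
rewrite opprD addrACA -!scalerBr; apply: le_trans (rnormD _ _) _.
rewrite !rnormZ !rnorm_emb //.
have -> : s * rdist W x + t * rdist W y + e =
          s * (rdist W x + e) + t * (rdist W y + e).
  by rewrite -[e in LHS]mul1r -st; ring.
by rewrite lerD // ler_wpM2l // ltW.
Qed.

End Distance.

(** * Nondentable sets *)

Section Dentability.
Variables (A : set X) (d M : R).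
Hypothesis A_bounded : forall a, A a -> rnorm a <= M.
Hypothesis A_nondentable : forall a, A a ->
  closure (convex_hull (A `\` [set b | rnorm (b - a) < d])) a.

Lemma closure_hull0 x : ~ closure (convex_hull (set0 : set X)) x.
Proof.
by rewrite convex_hull0 => /closure_rnorm /(_ 1 ltr01)[y].
Qed.

(** Let [W] be the new hull and [s] the supremum over [A] of the distance to [W]. If [s > 0], the
    points of [A] almost at distance [s] lie in a set of diameter less than [d]. Such a point is in
    the closed hull of points of [A] outside that set, and convexity of the distance contradicts its
    near maximality. *)
Lemma remove_ball (A1 : set X) (z : X) (r : R) : A1 `<=` A ->
  A `<=` closure (convex_hull A1) -> 0 <= r -> r + r < d ->
  A `<=` closure (convex_hull (A1 `\` [set x | rnorm (x - z) <= r])).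
Proof.
move=> A1A AA1 r0 rd a0 Aa0.
set W := convex_hull _.
have cW : rconvex W by exact: convex_hull_convex.
(* If nothing of [A1] is left, [A] lies in a ball of diameter less than [d], and nondentability
   would put a point in the closure of an empty hull. *)
have [W0|W0] := pselect (A1 `\` [set x | rnorm (x - z) <= r] !=set0); last first.
  have Az a : A a -> rnorm (a - z) <= r.
    move=> Aa; apply: (closure_hull_le (seminorm_convex_shift rnorm_seminorm z)
      (rnorm_lipschitz z) _ (AA1 _ Aa)) => y A1y.
    by apply: contrapT => yz; apply: W0; exists y.
  have := A_nondentable Aa0; rewrite (_ : _ `\` _ = set0) => [/closure_hull0//|].
  apply/seteqP; split=> // b [Ab] /=; apply.
  apply: le_lt_trans (rnorm_dist b z a0) (le_lt_trans _ rd).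
  by rewrite lerD ?Az // rnormB Az.
have {}W0 : W !=set0.
  by case: W0 => y Wy; exists y; exact: sub_convex_hull.
apply: (rdist_closure W0).
pose S := [set rdist W a | a in A].
have supS : has_sup S.
  split; first by exists (rdist W a0), a0.
  case: W0 => w Ww; exists (M + rnorm w) => _ [a Aa <-].
  apply: le_trans (rdist_le a Ww) _; apply: le_trans (rnormD _ _) _.
  by rewrite rnormN lerD // A_bounded.
have le_s a : A a -> rdist W a <= sup S.
  by move=> Aa; apply: sup_upper_bound => //; exists a.
apply: le_trans (le_s _ Aa0) _; rewrite leNgt; apply/negP => s0.
set s := sup S in s0 le_s *.
pose D := M + rnorm z + 1.
have M0 : 0 <= M by apply: le_trans (A_bounded Aa0); exact: rnorm_ge0.
have D0 : 0 < D by rewrite ltr_wpDl // addr_ge0 // rnorm_ge0.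
have Dz a : A a -> rnorm (a - z) <= D.
  move=> Aa; apply: le_trans (rnormD _ _) _.
  by rewrite rnormN -[leLHS]addr0 !lerD // A_bounded.
(* [g <= r + D] on [A1], hence on [A], and this confines the points of [A] whose
   distance to [W] is almost the supremum [s] to a ball of radius just above [r]. *)
pose g := (fun x => rnorm (x - z)) \+ (fun x => D / s * rdist W x).
have Ds0 : 0 <= D / s by rewrite divr_ge0 // ltW.
have cg : convexf g.
  apply: convexfD; first exact: seminorm_convex_shift rnorm_seminorm z.
  by apply: convexfZ => //; exact: rdist_convex.
have lg : lipschitzf g.
  apply: lipschitzfD; first exact: rnorm_lipschitz.
  by apply: lipschitzfZ => //; exact: rdist_lipschitz.
have gA a : A a -> g a <= r + D.
  move=> Aa; apply: (closure_hull_le cg lg _ (AA1 _ Aa)) => y A1y.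
  have Ay := A1A _ A1y; rewrite /g /=.
  (* In the ball the two terms of [g] are at most [r] and [D]; outside it the point belongs to [W]
     and only the first term remains. *)
  have [yz|yz] := leP (rnorm (y - z)) r.
    apply: lerD => //; rewrite mulrAC ler_pdivrMr // ler_wpM2l ?le_s //.
    exact: ltW.
  rewrite rdist_in //; last first.
    apply: sub_convex_hull; split => //= /le_lt_trans /(_ yz).
    by rewrite ltxx.
  by rewrite mulr0 addr0 -[leLHS]add0r lerD ?Dz.
(* Two points within [r + D * t] of [z] are then at distance at most [(d + 2 r) / 2], which is less
   than [d]. *)
have [t t0 Dt] : exists2 t, 0 < t & D * t = (d - (r + r)) / 4.
  exists ((d - (r + r)) / 4 / D); last by rewrite mulrC divfK ?lt0r_neq0.
  by rewrite !divr_gt0 // subr_gt0.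
have far a : A a -> s - s * t < rdist W a -> rnorm (a - z) < r + D * t.
  move=> Aa da; have := gA _ Aa; rewrite /g /= => ga.
  have : D - D * t < D / s * rdist W a.
    have -> : D - D * t = D / s * (s - s * t).
      by rewrite mulrBr [_ * (s * t)]mulrA divfK ?lt0r_neq0.
    by rewrite ltr_pM2l // divr_gt0.
  by move: ga; lra.
have [|_ [a Aa <-] sa] := sup_adherent (_ : 0 < s * t) supS.
  by rewrite mulr_gt0.
have az := far a Aa sa.
have : rdist W a <= s - s * t.
  apply: (closure_hull_le (rdist_convex W0 cW) (rdist_lipschitz W0) _
    (A_nondentable Aa)) => b [Ab /= ba].
  rewrite leNgt; apply/negP => /(far b Ab) bz; apply: ba.
  apply: le_lt_trans (rnorm_dist b z a) _; rewrite [rnorm (z - a)]rnormB.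
  by move: az bz; rewrite Dt; lra.
by rewrite leNgt sa.
Qed.

(** Balls are removed one at a time: [remove_ball] acts on what earlier removals left, while the
    nondentability used is always that of the whole of [A]. *)
Lemma remove_balls (zs : seq X) (r : R) : 0 <= r -> r + r < d ->
  A `<=` closure (convex_hull (A `\` [set x | exists2 z, z \in zs & rnorm (x - z) <= r])).
Proof.
move=> r0 rd; elim: zs => [|z zs IH] a Aa.
  rewrite (_ : _ `\` _ = A).
    by apply: subset_closure; exact: sub_convex_hull.
  by apply/seteqP; split=> [x []|x Ax] //; split=> // -[].
have A1A : A `\` [set x | exists2 y, y \in zs & rnorm (x - y) <= r] `<=` A.
  by move=> x [].
apply: closureS _ (remove_ball z A1A IH r0 rd Aa).
apply: convex_hullS => x [[Ax xzs] /= xz]; split=> // -[y].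
rewrite inE => /orP[/eqP->//|yzs xy].
by apply: xzs; exists y.
Qed.

End Dentability.
Definition finite_nets (W : set X) := forall e : R, 0 < e ->
  exists zs : seq X, forall x, W x -> exists2 z, z \in zs & rnorm (x - z) <= e.

(** A finite [d / 8]-net of [W] covers the [d / 8]-neighbourhood of [W] by balls of radius [d / 4],
    small enough for [remove_balls]. *)
Lemma remove_nets (A W : set X) (d M : R) : 0 < d ->
  (forall a, A a -> rnorm a <= M) ->
  (forall a, A a -> closure (convex_hull (A `\` [set b | rnorm (b - a) < d])) a) ->
  finite_nets W ->
  A `<=` closure (convex_hull (A `\` [set x | exists2 y, W y & rnorm (x - y) <= d / 8])).
Proof.
move=> d0 AM ndA netW a Aa.
have [|zs Wzs] := netW (d / 8); first by rewrite divr_gt0.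
have r0 : 0 <= d / 4 by lra.
have rd : d / 4 + d / 4 < d by lra.
apply: closureS _ (remove_balls AM ndA zs r0 rd Aa).
apply: convex_hullS => x [Ax xzs]; split=> // -[y Wy xy]; apply: xzs => /=.
have [z zzs yz] := Wzs _ Wy; exists z => //.
apply: le_trans (rnorm_dist x y z) _; lra.
Qed.

(** * Reduction of a nondentable set to a sequence *)

Lemma finite_convex_hull (E : set X) x : convex_hull E x ->
  exists l : seq X, (forall y, y \in l -> E y) /\ convex_hull [set` l] x.
Proof.
move: x; apply: convex_hull_sub => [x y s t s0 t0 st [l [lE lx]] [m [mE my]]|x Ex].
  exists (l ++ m); split=> [z|].
    by rewrite mem_cat => /orP[/lE|/mE].
  apply: convex_hull_convex => //.
    by apply: convex_hullS lx => z /= zl; rewrite mem_cat zl.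
  by apply: convex_hullS my => z /= zl; rewrite mem_cat zl orbT.
exists [:: x]; split=> [y|]; first by rewrite inE => /eqP->.
by apply: sub_convex_hull; rewrite /= mem_head.
Qed.

(** Approximating one point within one tolerance takes only finitely many far points, so closing
    [a0] under these choices for the tolerances [1 / (m + 1)] yields a countable set. *)
Lemma nondentable_sequence (A : set X) (d : R) : A !=set0 ->
  (forall a, A a -> closure (convex_hull (A `\` [set b | rnorm (b - a) < d])) a) ->
  exists u : nat -> X, (forall n, A (u n)) /\
    forall a, range u a ->
      closure (convex_hull (range u `\` [set b | rnorm (b - a) < d])) a.
Proof.
move=> [a0 Aa0] ndA.
(* Membership in [A] is put under the existential so that choice gives a function on all pairs. *)
have : forall am : X * nat, exists l : seq X, A am.1 ->
    (forall y, y \in l -> (A `\` [set b | rnorm (b - am.1) < d]) y) /\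
    exists2 y, convex_hull [set` l] y & rnorm (am.1 - y) < am.2.+1%:R^-1.
  move=> [a m] /=; have [Aa|nAa] := pselect (A a); last by exists [::].
  have /closure_rnorm /(_ m.+1%:R^-1) := ndA _ Aa.
  case; first by rewrite invr_gt0 ltr0n.
  by move=> y /finite_convex_hull[l [lA ly]] ya; exists l; split=> //; exists y.
move=> /choice[L LP].
(* The nodes of the tree: a child of [a] is one of the finitely many points far
   from [a] whose convex hull passes at distance less than [1 / (m + 1)] of [a]. *)
pose fix node (p : seq (nat * nat)) : X :=
  if p is (m, j) :: q then nth (node q) (L (node q, m)) j else a0.
have nodeA (p : seq (nat * nat)) : A (node p).
  elim: p => //= -[m j] q IH /=.
  (* An index beyond the list gives back the parent, which is in [A] by induction. *)
  have [jl|jl] := ltnP j (size (L (node q, m))); last by rewrite nth_default.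
  by have [lA _] := LP (node q, m) IH; case: (lA _ (mem_nth (node q) jl)).
(* Integers that code no path are sent to the root. *)
pose u n := node (odflt [::] (unpickle n)).
have uE (p : seq (nat * nat)) : u (pickle p) = node p by rewrite /u pickleK.
exists u; split=> [n|a [n _ <-]]; first exact: nodeA.
rewrite -[u n]/(node (odflt [::] (unpickle n))); set p := odflt _ _.
apply/closure_rnorm => e e0.
have [m me] : exists m : nat, m.+1%:R^-1 < e.
  exists (Num.bound e^-1); rewrite invf_plt ?posrE ?ltr0n //.
  apply: lt_trans (archi_boundP _) _; first by rewrite invr_ge0 ltW.
  by rewrite ltr_nat.
have [lA [y hy ya]] := LP (node p, m) (nodeA p).
exists y; last exact: lt_trans ya me.
apply: convex_hullS hy => z /= zl; split; last by case: (lA z zl).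
exists (pickle ((m, index z (L (node p, m))) :: p)) => //.
by rewrite uE /= nth_index.
Qed.

Definition circled (W : set X) := forall (w : K) x, `|w| = 1 -> W x -> W (w *: x).

(** * Hulls of finitely many circles *)

Section FiniteHulls.
Hypothesis disc_nets : forall e : R, 0 < e -> exists s : seq K,
  forall k : K, `|k| <= 1 -> exists2 l, l \in s & `|k - l| <= emb e.

Variable a : nat -> X.

(** All unimodular multiples are taken so that the hulls are circled and their gauges homogeneous
    over [K]. The bound on [j] is inclusive, so that even [orbits 0] is nonempty. *)
Definition orbits (n : nat) : set X :=
  [set x | exists j, exists2 w : K, (j <= n)%N /\ `|w| = 1 & x = w *: a j].

Definition hull_upto n := convex_hull (orbits n).

Lemma hull_upto_convex n : rconvex (hull_upto n).
Proof. exact: convex_hull_convex. Qed.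

Lemma circled_convex_hull (E : set X) : circled E -> circled (convex_hull E).
Proof.
move=> cE w x w1; move: x; apply: convex_hull_sub => [x y s t s0 t0 st /= hx hy|x Ex].
  rewrite scalerDr !scalerA ![w * _]mulrC -!scalerA.
  exact: convex_hull_convex.
by apply: sub_convex_hull; exact: cE.
Qed.

Lemma orbits_circled n : circled (orbits n).
Proof.
move=> w _ w1 [j [v [jn v1] ->]]; exists j, (w * v); last by rewrite scalerA.
by rewrite normrM w1 v1 mulr1.
Qed.

Lemma hull_upto_circled n : circled (hull_upto n).
Proof. by apply: circled_convex_hull; exact: orbits_circled. Qed.

Lemma circled_convex0 (E : set X) : circled E -> rconvex E -> E !=set0 -> E 0.
Proof.
move=> ciE cE [x Ex]; have Enx : E (- x).
  by rewrite -scaleN1r; apply: ciE => //; rewrite normrN normr1.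
have := cE x (- x) (2^-1) (2^-1); rewrite scalerN subrr.
by apply=> //; rewrite ?invr_ge0 //; lra.
Qed.

Lemma hull_upto0 n : hull_upto n 0.
Proof.
apply: circled_convex0; [exact: hull_upto_circled|exact: hull_upto_convex|].
exists (a 0); apply: sub_convex_hull; exists 0%N, 1; last by rewrite scale1r.
by rewrite normr1.
Qed.

Lemma hull_uptoS m n : (m <= n)%N -> hull_upto m `<=` hull_upto n.
Proof.
move=> mn; apply: convex_hullS => x [j [w [jm w1] ->]]; exists j, w => //.
by rewrite (leq_trans jm mn).
Qed.

Lemma hull_upto_le n (M : R) : (forall j, rnorm (a j) <= M) ->
  forall x, hull_upto n x -> rnorm x <= M.
Proof.
move=> aM; apply: convex_hull_sub.
  exact: sublevel_convex (seminorm_convex rnorm_seminorm).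
move=> _ [j [w [_ w1] ->]] /=; rewrite rnormZ.
by rewrite (_ : rnorm w = 1) ?mul1r // /rnorm w1 -(rmorph1 emb) embK.
Qed.

(* A sum of discs, which contains [hull_upto] and is clearly totally bounded. *)
Fixpoint discs (n : nat) : set X :=
  if n is m.+1 then [set x | exists y, exists2 k : K, discs m y /\ `|k| <= 1 &
                        x = y + k *: a m]
  else [set 0].

Lemma discs_convex n : rconvex (discs n).
Proof.
elim: n => [|n IH] x y s t s0 t0 st /=; first by move=> -> ->; rewrite !scaler0 addr0.
move=> [x' [k [dx k1] ->]] [y' [l [dy l1] ->]].
exists (emb s *: x' + emb t *: y'), (emb s * k + emb t * l).
  split; first exact: IH.
  apply: le_trans (ler_normD _ _) _; rewrite !normrM.
  rewrite (ger0_norm (_ : 0 <= emb s)) ?(ger0_norm (_ : 0 <= emb t)) ?emb_ge0 //.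
  rewrite -(rmorph1 emb) -st rmorphD /=.
  by rewrite lerD // ler_piMr ?emb_ge0.
by rewrite !scalerDr !scalerA addrACA -scalerDl.
Qed.

Lemma discs0 n : discs n 0.
Proof.
elim: n => //= n IH; exists 0, 0; last by rewrite scale0r addr0.
by rewrite normr0 ler01.
Qed.

Lemma discs_orbit n j (w : K) : (j < n)%N -> `|w| = 1 -> discs n (w *: a j).
Proof.
elim: n => // n IH; rewrite ltnS leq_eqVlt => /orP[/eqP-> w1|jn w1] /=.
  by exists 0, w; rewrite ?add0r // w1; split=> //; exact: discs0.
exists (w *: a j), 0; last by rewrite scale0r addr0.
by rewrite normr0 ler01; split=> //; exact: IH.
Qed.

Lemma discs_nets n : finite_nets (discs n).
Proof.
elim: n => [|n IH] e e0 /=.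
  exists [:: 0] => x ->; exists 0; first exact: mem_head.
  by rewrite subrr rnorm0 ltW.
have e2 : 0 < e / 2 by rewrite divr_gt0.
have [zs zsP] := IH (e / 2) e2.
have a0 : 0 < rnorm (a n) + 1 by rewrite ltr_wpDl // rnorm_ge0.
have [|s sP] := disc_nets (_ : 0 < e / 2 / (rnorm (a n) + 1)).
  by rewrite divr_gt0.
exists [seq z + l *: a n | z <- zs, l <- s] => _ [y [k [dy k1] ->]].
have [z zzs yz] := zsP _ dy; have [l ls kl] := sP _ k1.
exists (z + l *: a n); first exact: allpairs_f.
rewrite opprD addrACA -scalerBl [e]splitr; apply: le_trans (rnormD _ _) _.
rewrite lerD // rnormZ.
have {}kl : rnorm (k - l) <= e / 2 / (rnorm (a n) + 1).
  by rewrite -emb_le embn.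
apply: le_trans (ler_wpM2r (rnorm_ge0 _) kl) _.
rewrite mulrAC ler_pdivrMr // ler_wpM2l ?lerDl //.
exact: ltW.
Qed.

(** The hull lies in the convex set [discs n.+1]; the shift is due to the strict bound on indices in
    [discs]. *)
Lemma hull_upto_nets n : finite_nets (hull_upto n).
Proof.
move=> e e0; have [zs zsP] := discs_nets n.+1 e0; exists zs => x hx; apply: zsP.
apply: convex_hull_sub (@discs_convex n.+1) _ _ hx => _ [j [w [jn w1] ->]].
exact: discs_orbit.
Qed.

End FiniteHulls.
(** * Gauges and their weighted sums *)

(* [gauge C r] is the Minkowski gauge of the sum of [C] and of the ball of radius [r]. *)
Definition gauge_witness (C : set X) (r : R) x (t : R) :=
  0 < t /\ exists2 c, C c & rnorm (x - emb t *: c) <= t * r.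

Definition gauge (C : set X) (r : R) x : R := inf [set t | gauge_witness C r x t].

Section Gauge.
Variables (C : set X) (r M : R).
Hypothesis C_convex : rconvex C.
Hypothesis C_circled : circled C.
Hypothesis C0 : C 0.
Hypothesis C_le : forall c, C c -> rnorm c <= M.
Hypothesis r_gt0 : 0 < r.

Lemma gauge_witness_has_inf x : has_inf [set t | gauge_witness C r x t].
Proof.
split; last by exists 0 => t [/ltW].
exists (rnorm x / r + 1); split.
  by rewrite ltr_wpDl // divr_ge0 ?rnorm_ge0 // ltW.
exists 0 => //; rewrite scaler0 subr0 mulrDl divfK ?lt0r_neq0 //.
by rewrite lerDl mul1r ltW.
Qed.

Lemma gauge_le x t : gauge_witness C r x t -> gauge C r x <= t.
Proof.
by move=> xt; apply: ge_inf => //; case: (gauge_witness_has_inf x).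
Qed.

(** Witnesses are upward closed: a witness [s < t] is enlarged by shrinking its point of [C] towards
    0 by the factor [s / t]. *)
Lemma gauge_lt x t : gauge C r x < t -> gauge_witness C r x t.
Proof.
move=> xt; have [|s [s0 [c Cc xc]]] := inf_adherent (_ : 0 < t - gauge C r x)
    (gauge_witness_has_inf x).
  by rewrite subr_gt0.
rewrite -/(gauge C r x) [ltRHS]addrC subrK => st.
have t0 := lt_trans s0 st.
split=> //; exists (emb (s / t) *: c).
  have st1 : s / t <= 1 by rewrite ler_pdivrMr // mul1r ltW.
  rewrite -[_ *: _]addr0 -(scaler0 _ (emb (1 - s / t))).
  apply: C_convex => //; first by rewrite divr_ge0 // ltW.
    by rewrite subr_ge0.
  by rewrite addrC subrK.
rewrite scalerA -rmorphM [t * _]mulrC divfK ?lt0r_neq0 //.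
by apply: le_trans xc _; rewrite ler_wpM2r // ltW.
Qed.

Lemma gauge_ge0 x : 0 <= gauge C r x.
Proof.
by rewrite leNgt; apply/negP => /gauge_lt[]; rewrite ltxx.
Qed.

Lemma gauge_le_rnorm x : gauge C r x <= rnorm x / r.
Proof.
apply/ler_addgt0Pr => e e0; apply: gauge_le; split.
  by rewrite ltr_wpDl // divr_ge0 ?rnorm_ge0 // ltW.
exists 0 => //; rewrite scaler0 subr0 mulrDl divfK ?lt0r_neq0 //.
by rewrite lerDl mulr_ge0 // ltW.
Qed.

Lemma rnorm_le_gauge x : rnorm x <= (M + r) * gauge C r x.
Proof.
have Mr : 0 < M + r by rewrite ltr_wpDl // -(rnorm0 X) C_le.
rewrite -ler_pdivrMl //; apply/ler_addgt0Pr => e e0.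
have [|t0 [c Cc xc]] := @gauge_lt x (gauge C r x + e); first by rewrite ltrDl.
rewrite ler_pdivrMl //; apply: le_trans (seminorm_dist rnorm_seminorm x _) _.
apply: le_trans (lerD (lexx _) xc) _.
rewrite (seminormZ rnorm_seminorm) ?(ltW t0) // -mulrDr [leRHS]mulrC.
by rewrite ler_wpM2l ?(ltW t0) // lerD2r C_le.
Qed.

Lemma gauge_seminorm : seminorm (gauge C r).
Proof.
apply: seminorm_le => [x y|k x k0|].
- apply/ler_addgt0Pr => e e0; have e2 : 0 < e / 2 by rewrite divr_gt0.
  have [|t0 [c Cc xc]] := @gauge_lt x (gauge C r x + e / 2); first by rewrite ltrDl.
  have [|s0 [b Cb yb]] := @gauge_lt y (gauge C r y + e / 2); first by rewrite ltrDl.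
  set t := _ + e / 2 in t0 xc; set s := _ + e / 2 in s0 yb.
  have -> : gauge C r x + gauge C r y + e = t + s.
    by rewrite [e in LHS]splitr addrACA.
  have ts0 : 0 < t + s by exact: addr_gt0.
  apply: gauge_le; split=> //.
  exists (emb (t / (t + s)) *: c + emb (s / (t + s)) *: b).
    by apply: C_convex => //; rewrite ?divr_ge0 ?(ltW t0) ?(ltW s0) ?(ltW ts0) //
      -mulrDl mulfV // lt0r_neq0.
  rewrite scalerDr !scalerA -!rmorphM ![(t + s) * (_ / _)]mulrC !divfK ?lt0r_neq0 //.
  rewrite opprD addrACA mulrDl.
  by apply: le_trans (rnormD _ _) _; exact: lerD.
- apply/ler_addgt0Pr => e e0.
  have kn0 := rnorm_gt0 k0.
  have [|t0 [c Cc xc]] := @gauge_lt x (gauge C r x + e / rnorm k).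
    by rewrite ltrDl divr_gt0.
  set t := _ + _ in t0 xc.
  have -> : rnorm k * gauge C r x + e = rnorm k * t.
    by rewrite mulrDr [_ * (e / _)]mulrC divfK ?lt0r_neq0.
  apply: gauge_le; split; first exact: mulr_gt0.
  (* The phase of [k] is absorbed by [C], which is circled; its modulus rescales [t]. *)
  exists ((k / `|k|) *: c).
    by apply: C_circled => //; rewrite normrM normfV normr_id mulfV // normr_eq0.
  rewrite scalerA rmorphM /= embn mulrAC [k / _]mulrC mulrA mulfV ?normr_eq0 //.
  rewrite mul1r -scalerA -scalerBr rnormZ -mulrA ler_wpM2l //.
  exact: rnorm_ge0.
- apply/eqP; rewrite eq_le gauge_ge0 andbT.
  by apply: le_trans (gauge_le_rnorm _) _; rewrite rnorm0 mul0r.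
Qed.

End Gauge.

Section WeightedSum.
Variables (q : nat -> X -> R) (B : R).
Hypothesis q_seminorm : forall k, seminorm (q k).
Hypothesis q_le : forall k x, q k x <= B * rnorm x.

Definition psum (w : nat -> R) n x := \sum_(k < n) w k * q k x.

(** The terms are nonnegative in all uses, so the supremum of the partial sums is the sum of the
    series. *)
Definition wsum (w : nat -> R) x : R := sup (range (fun n => psum w n x)).

Section Weights.
Variable w : nat -> R.
Hypothesis w_ge0 : forall k, 0 <= w k.
Hypothesis w_le1 : forall n, \sum_(k < n) w k <= 1.

Lemma psum_ge0 n x : 0 <= psum w n x.
Proof. by apply: sumr_ge0 => k _; rewrite mulr_ge0 // seminorm_ge0. Qed.

Lemma psum_bound n x : psum w n x <= B * rnorm x.
Proof.
have Bx0 : 0 <= B * rnorm x by apply: le_trans (q_le 0 x); exact: seminorm_ge0.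
apply: le_trans (_ : \sum_(k < n) w k * (B * rnorm x) <= _).
  by apply: ler_sum => k _; rewrite ler_wpM2l.
by rewrite -mulr_suml ler_piMl.
Qed.

Lemma psum_has_sup x : has_sup (range (fun n => psum w n x)).
Proof.
split; first by exists (psum w 0 x), 0%N.
by exists (B * rnorm x) => _ [n _ <-]; exact: psum_bound.
Qed.

Lemma psum_le n x : psum w n x <= wsum w x.
Proof. by apply: sup_upper_bound; [exact: psum_has_sup|exists n]. Qed.

Lemma wsum_le x t : (forall n, psum w n x <= t) -> wsum w x <= t.
Proof.
by move=> xt; apply: ge_sup; [exists (psum w 0 x), 0%N|move=> _ [n _ <-]].
Qed.

Lemma wsum_bound x : wsum w x <= B * rnorm x.
Proof. by apply: wsum_le => n; exact: psum_bound. Qed.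

Lemma wsum_seminorm : seminorm (wsum w).
Proof.
apply: seminorm_le => [x y|k x _|].
- apply: wsum_le => n; apply: le_trans (lerD (psum_le n x) (psum_le n y)).
  rewrite /psum -big_split; apply: ler_sum => k _ /=.
  by rewrite -mulrDr ler_wpM2l //; case: (q_seminorm k).
- apply: wsum_le => n.
  rewrite (_ : psum w n (k *: x) = rnorm k * psum w n x).
    by rewrite ler_wpM2l ?rnorm_ge0 // psum_le.
  rewrite /psum mulr_sumr; apply: eq_bigr => j _.
  by rewrite (proj2 (q_seminorm j)) mulrCA.
- apply/eqP; rewrite eq_le (le_trans _ (psum_le 0 0)) ?andbT; last first.
    exact: psum_ge0.
  by apply: le_trans (wsum_bound _) _; rewrite rnorm0 mulr0.
Qed.

End Weights.

Definition dropw (w : nat -> R) k j : R := if j == k then 0 else w j.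

Lemma psum_dropw (w : nat -> R) k n x : (k < n)%N ->
  psum w n x = psum (dropw w k) n x + w k * q k x.
Proof.
move=> kn; rewrite /psum (bigD1 (Ordinal kn)) //= [in RHS](bigD1 (Ordinal kn)) //=.
rewrite /dropw eqxx mul0r add0r addrC; congr (_ + _); apply: eq_bigr => j jk.
by rewrite ifN.
Qed.

(** Isolates the [k]-th gauge: what is left is again a seminorm, to which the convexity arguments
    apply. *)
Lemma wsum_dropw (w : nat -> R) k x : (forall j, 0 <= w j) ->
  (forall n, \sum_(j < n) w j <= 1) ->
  seminorm (wsum (dropw w k)) /\ wsum w x = wsum (dropw w k) x + w k * q k x.
Proof.
move=> w0 w1.
have v0 j : 0 <= dropw w k j by rewrite /dropw; case: ifP.
have vw j : dropw w k j <= w j by rewrite /dropw; case: ifP.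
have v1 n : \sum_(j < n) dropw w k j <= 1.
  by apply: le_trans (w1 n); exact: ler_sum.
split; first exact: wsum_seminorm.
have mono (u : nat -> R) n m : (forall j, 0 <= u j) -> psum u n x <= psum u (n + m) x.
  move=> u0; rewrite /psum big_split_ord /= lerDl sumr_ge0 // => j _.
  by rewrite mulr_ge0 // seminorm_ge0.
apply/eqP; rewrite eq_le; apply/andP; split.
  (* Partial sums are lengthened so that they contain the index [k]. *)
  apply: wsum_le => n; apply: le_trans (mono w n k.+1 w0) _.
  by rewrite (@psum_dropw _ k) ?lerD2r ?psum_le // addnS ltnS leq_addl.
rewrite -lerBrDr; apply: wsum_le => n; rewrite lerBrDr.
apply: le_trans (psum_le w0 w1 (n + k.+1) x).
rewrite [leRHS](@psum_dropw _ k) ?lerD2r; first exact: mono v0.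
by rewrite addnS ltnS leq_addl.
Qed.

End WeightedSum.

Definition dyadic (k : nat) : R := 2^-1 ^+ k.+1.

Lemma dyadic_gt0 k : 0 < dyadic k.
Proof. by rewrite exprn_gt0 // invr_gt0. Qed.

Lemma dyadic_sum n : \sum_(k < n) dyadic k <= 1.
Proof.
suff -> : \sum_(k < n) dyadic k = 1 - 2^-1 ^+ n.
  by rewrite gerBl exprn_ge0 // invr_ge0.
elim: n => [|n IH]; first by rewrite big_ord0 expr0 subrr.
rewrite big_ord_recr /= IH /dyadic [in RHS]exprS exprS; lra.
Qed.

Lemma rconvex_unit_sum (z : X) s t : s + t = 1 -> emb s *: z + emb t *: z = z.
Proof. by move=> st; rewrite -scalerDl -rmorphD st rmorph1 scale1r. Qed.

(** * The two norms *)

Section Renorming.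
Hypothesis disc_nets : forall e : R, 0 < e -> exists s : seq K,
  forall k : K, `|k| <= 1 -> exists2 l, l \in s & `|k - l| <= emb e.

Variables (a : nat -> X) (d M : R).
Hypothesis d_gt0 : 0 < d.
Hypothesis a_le : forall n, rnorm (a n) <= M.
Hypothesis a_nondentable : forall x, range a x ->
  closure (convex_hull (range a `\` [set b | rnorm (b - x) < d])) x.

(** The radius is small against the separation [d / 8] in [far_orbits]: the errors met later add up
    to [6 * r]. *)
Let r := d / 64.
Let r_gt0 : 0 < r. Proof. by rewrite divr_gt0. Qed.

Definition hull_all : set X := [set x | exists n, hull_upto a n x].

Lemma hull_all_convex : rconvex hull_all.
Proof.
move=> x y s t s0 t0 st [m hx] [n hy]; exists (maxn m n).
apply: hull_upto_convex => //.
  exact: hull_uptoS (leq_maxl _ _) _ hx.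
exact: hull_uptoS (leq_maxr _ _) _ hy.
Qed.

Lemma hull_all_circled : circled hull_all.
Proof. by move=> w x w1 [n hx]; exists n; exact: hull_upto_circled. Qed.

Lemma hull_all0 : hull_all 0.
Proof. by exists 0%N; exact: hull_upto0. Qed.

Lemma hull_all_le x : hull_all x -> rnorm x <= M.
Proof. by move=> [n]; exact: hull_upto_le. Qed.

Definition far_orbits k : set X := [set x | (exists n, orbits a n x) /\
  ~ exists2 y, hull_upto a k y & rnorm (x - y) <= d / 8].

(** States, through convex Lipschitz functions, that [hull_all] lies in the closed convex hull of
    [far_orbits k]. It suffices to bound [f] on each circle, where [remove_nets] applies to the
    totally bounded set [hull_upto a k]. *)
Lemma far_le f s k : convexf f -> lipschitzf f ->
  (forall x, far_orbits k x -> f x <= s) -> forall c, hull_all c -> f c <= s.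
Proof.
move=> cf [L L0 lf] fs c [n]; move: c; apply: convex_hull_sub.
  exact: sublevel_convex.
(* Rotating the function instead of the points lets the nondentability of [range a] suffice. *)
move=> _ [j [w [_ w1] ->]] /=; pose g x := f (w *: x).
have rw : rnorm w = 1 by rewrite /rnorm w1 -(rmorph1 emb) embK.
have cg : convexf g.
  move=> x y p t p0 t0 pt; rewrite /g scalerDr !scalerA ![w * _]mulrC -!scalerA.
  exact: cf.
have lg : lipschitzf g.
  exists L => // x y; rewrite /g; apply: le_trans (lf _ (w *: y)) _.
  by rewrite -scalerBr rnormZ rw mul1r.
have aM x : range a x -> rnorm x <= M by case=> i _ <-; exact: a_le.
apply: (closure_hull_le cg lg _
  (remove_nets d_gt0 aM a_nondentable (@hull_upto_nets disc_nets a k) _)); last by exists j.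
move=> _ [[i _ <-] /= far]; apply: fs; split; first by exists i, i, w.
(* Division by the unimodular [w] preserves the circled set [hull_upto a k] and distances. *)
move=> [y hy ay]; apply: far; exists (w^-1 *: y).
  by apply: hull_upto_circled => //; rewrite normfV w1 invr1.
have w0 : w != 0 by rewrite -normr_eq0 w1 oner_neq0.
by rewrite -(scalerK w0 (a i)) -scalerBr rnormZ (_ : rnorm w^-1 = 1) ?mul1r //
  /rnorm normfV w1 invr1 -(rmorph1 emb) embK.
Qed.

Definition gauge_upto k := gauge (hull_upto a k) r.
Definition gauge_all := gauge hull_all r.
Definition gauge_sum := wsum gauge_upto dyadic.

Lemma gauge_upto_seminorm k : seminorm (gauge_upto k).
Proof.
apply: gauge_seminorm => //; [exact: hull_upto_convex|exact: hull_upto_circled|].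
exact: hull_upto0.
Qed.

Lemma gauge_upto_le k x : gauge_upto k x <= r^-1 * rnorm x.
Proof. by rewrite mulrC; apply: gauge_le_rnorm => //; exact: hull_upto0. Qed.

Lemma gauge_upto_lt k x t : gauge_upto k x < t -> gauge_witness (hull_upto a k) r x t.
Proof. by apply: gauge_lt => //; [exact: hull_upto_convex|exact: hull_upto0]. Qed.

Lemma gauge_all_seminorm : seminorm gauge_all.
Proof.
apply: gauge_seminorm => //; [exact: hull_all_convex|exact: hull_all_circled|].
exact: hull_all0.
Qed.

Lemma gauge_all_le x : gauge_all x <= r^-1 * rnorm x.
Proof. by rewrite mulrC; apply: gauge_le_rnorm => //; exact: hull_all0. Qed.

Lemma gauge_all_lt x t : gauge_all x < t -> gauge_witness hull_all r x t.
Proof. by apply: gauge_lt => //; [exact: hull_all_convex|exact: hull_all0]. Qed.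

Lemma rnorm_gauge_all x : rnorm x <= (M + r) * gauge_all x.
Proof.
apply: rnorm_le_gauge => //;
  [exact: hull_all_convex|exact: hull_all0|exact: hull_all_le].
Qed.

Lemma gauge_sum_seminorm : seminorm gauge_sum.
Proof.
apply: (wsum_seminorm gauge_upto_seminorm gauge_upto_le); last exact: dyadic_sum.
by move=> k; rewrite ltW // dyadic_gt0.
Qed.

Lemma gauge_sum_le x : gauge_sum x <= r^-1 * rnorm x.
Proof.
apply: (wsum_bound gauge_upto_seminorm gauge_upto_le); last exact: dyadic_sum.
by move=> k; rewrite ltW // dyadic_gt0.
Qed.

Lemma Mr_gt0 : 0 < M + r.
Proof. by rewrite ltr_wpDl //; apply: le_trans (a_le 0); exact: rnorm_ge0. Qed.

(** The term of index 0 suffices; its weight [1 / 2] accounts for the factor 2. *)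
Lemma rnorm_gauge_sum x : rnorm x <= 2 * (M + r) * gauge_sum x.
Proof.
apply: le_trans (_ : (M + r) * gauge_upto 0 x <= _).
  apply: rnorm_le_gauge => //; [exact: hull_upto_convex|exact: hull_upto0|].
  exact: hull_upto_le.
rewrite [2 * _]mulrC -mulrA ler_wpM2l ?(ltW Mr_gt0) //.
rewrite -ler_pdivrMl //.
have := psum_le gauge_upto_seminorm gauge_upto_le _ dyadic_sum 1 x.
rewrite /psum big_ord1 /dyadic expr1; apply.
by move=> k; rewrite ltW // dyadic_gt0.
Qed.

Lemma gauge_sum_drop k x : seminorm (wsum gauge_upto (dropw dyadic k)) /\
  gauge_sum x = wsum gauge_upto (dropw dyadic k) x + dyadic k * gauge_upto k x.
Proof.
apply: (wsum_dropw gauge_upto_seminorm gauge_upto_le); last exact: dyadic_sum.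
by move=> j; rewrite ltW // dyadic_gt0.
Qed.

(** Normalised so that [theta * (M + r) = r]. A perturbation of norm at most [theta * r] changes
    each gauge by at most [theta]. *)
Let theta := d / (64 * (M + r)).

(** [S] is a bare map of [X], so that it can be compared with the identity although the operators
    act between two renormings; [sigma] stands for the operator norm. *)
Lemma not_quasi_attained (S : X -> X) (u : X) (sigma : R) :
  (forall x y, S (x + y) = S x + S y) -> (forall (k : K) x, S (k *: x) = k *: S x) ->
  (forall x, rnorm (S x - x) <= theta * r * gauge_all x) ->
  (forall x, gauge_sum (S x) <= sigma * gauge_all x) ->
  (forall e, 0 < e -> exists2 x, gauge_all x <= 1 & rnorm (u - S x) < e) ->
  gauge_sum u = sigma -> False.
Proof.
move=> SD SZ nearS Ssigma uS usigma.
have SB x y : S (x - y) = S x - S y by rewrite SD -scaleN1r SZ scaleN1r.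
have Mr := Mr_gt0.
have theta_gt0 : 0 < theta by rewrite divr_gt0 // mulr_gt0.
have thetaE : theta * (M + r) = d / 64.
  by rewrite /theta invfM mulrA -mulrA mulVf ?mulr1 // lt0r_neq0.
have sigma_ge0 : 0 <= sigma by rewrite -usigma (seminorm_ge0 gauge_sum_seminorm).
have near1 x : gauge_all x <= 1 -> rnorm (S x - x) <= theta * r.
  move=> x1; apply: le_trans (nearS x) _.
  by rewrite ler_piMr // mulr_ge0 // ltW.
have qu : gauge_all u <= 1 + theta.
  apply/ler_addgt0Pr => e e0.
  have [|x x1 ux] := uS (e * r); first exact: mulr_gt0.
  have h1 := seminorm_dist gauge_all_seminorm u (S x).
  have h2 := seminorm_dist gauge_all_seminorm (S x) x.
  have h3 : gauge_all (u - S x) <= e.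
    apply: le_trans (gauge_all_le _) _; rewrite ler_pdivrMl // mulrC.
    exact: ltW.
  have h4 : gauge_all (S x - x) <= theta.
    apply: le_trans (gauge_all_le _) _; rewrite ler_pdivrMl // mulrC.
    exact: near1.
  lra.
(* The point of [hull_all] that witnesses this gauge already lies in some [hull_upto a k]; this
   fixes [k]. *)
have [|t0 [c [k hc] uc]] := @gauge_all_lt u (1 + 2 * theta); first lra.
have qku : gauge_upto k u <= 1 + 2 * theta.
  by apply: gauge_le => //; [exact: hull_upto0|split=> //; exists c].
have [sNk _] := gauge_sum_drop k u.
have NE x := proj2 (gauge_sum_drop k x).
set Nk := wsum _ _ in sNk NE.
have wk := dyadic_gt0 k.
set kappa := sigma - dyadic k * (gauge_upto k u + theta).
have NkN x : Nk x <= gauge_sum x.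
  by rewrite NE lerDl mulr_ge0 ?(ltW wk) ?(seminorm_ge0 (gauge_upto_seminorm k)).
have far_kappa x y : far_orbits k x -> rnorm y <= r -> Nk (S (x + y)) <= kappa.
  move=> [[n ox] far] yr.
  have q1 : gauge_all (x + y) <= 1.
    apply: gauge_le => //; first exact: hull_all0.
    split=> //; exists x; last by rewrite rmorph1 scale1r addrC addKr mul1r.
    by exists n; exact: sub_convex_hull.
  have N1 : gauge_sum (S (x + y)) <= sigma.
    by apply: le_trans (Ssigma _) _; rewrite ler_piMr.
  rewrite /kappa lerBrDr; apply: le_trans N1; rewrite NE lerD2l ler_wpM2l ?(ltW wk) //.
  (* Otherwise [gauge_upto k (x + y)] is below [1 + 4 * theta], which brings [x] too near to
     [hull_upto a k]. *)
  rewrite leNgt; apply/negP => qk; apply: far.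
  have qk2 : gauge_upto k (S (x + y) - (x + y)) <= theta.
    apply: le_trans (gauge_upto_le _ _) _; rewrite ler_pdivrMl // mulrC.
    exact: near1.
  have [|t1 [b hb xb]] := @gauge_upto_lt k (x + y) (1 + 4 * theta).
    have := seminorm_dist (gauge_upto_seminorm k) (x + y) (S (x + y)).
    rewrite (seminormB (gauge_upto_seminorm k)); lra.
  exists b => //.
  have -> : x - b = (x + y - emb (1 + 4 * theta) *: b) + (emb (4 * theta) *: b - y).
    rewrite rmorphD rmorph1 scalerDl scale1r opprD.
    by rewrite [x + y + _]addrA addrA subrK [x + y - b]addrAC addrK.
  apply: le_trans (rnormD _ _) _; apply: le_trans (lerD xb (rnormD _ _)) _.
  have bM : rnorm b <= M by apply: hull_upto_le hb.
  rewrite rnormN rnormZ rnorm_emb; last by rewrite mulr_ge0 // ltW.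
  (* The distance is at most [(1 + 4 theta) r + 4 theta M + r = 2 r + 4 theta (M + r) = 6 d / 64],
     less than [d / 8]. *)
  have : theta * rnorm b <= theta * M by rewrite ler_wpM2l // ltW.
  move: thetaE yr; rewrite -/r mulrDr mulrDl mul1r -!(mulrA 4).
  have rE : r = d / 64 by [].
  by have := d_gt0; move: (theta * r) (theta * rnorm b) (theta * M) => ? ? ?; lra.
(* With [y] fixed, the left side is convex and Lipschitz in the other point, so [far_le] applies. *)
have hull_kappa c' y : hull_all c' -> rnorm y <= r -> Nk (S (c' + y)) <= kappa.
  move=> hc' yr; pose f x := Nk (S (x + y)).
  apply: (@far_le f kappa k _ _ _ c' hc').
  - move=> x z s t s0 t1 st; rewrite /f.
    have -> : emb s *: x + emb t *: z + y = emb s *: (x + y) + emb t *: (z + y).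
      by rewrite !scalerDr addrACA rconvex_unit_sum.
    by rewrite (SD (emb s *: _)) !SZ; exact: seminorm_convex.
  - exists (sigma * r^-1); first by rewrite mulr_ge0 // invr_ge0 ltW.
    move=> x z; apply: le_trans (seminorm_dist sNk _ (S (z + y))) _.
    rewrite lerD2l -SB opprD addrACA subrr addr0.
    apply: le_trans (NkN _) _; apply: le_trans (Ssigma _) _.
    by rewrite -mulrA ler_wpM2l // gauge_all_le.
  - by move=> x fx; exact: far_kappa.
have kappa_ge0 : 0 <= kappa.
  apply: le_trans (hull_kappa 0 0 hull_all0 _); first exact: seminorm_ge0.
  by rewrite rnorm0 ltW.
(* A gauge at most 1 only puts [x] in [t] times the sum of [hull_all] and the ball for every
   [t > 1]; as [kappa] is nonnegative, the excess tends to 0 with [t - 1]. *)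
have ball_kappa x : gauge_all x <= 1 -> Nk (S x) <= kappa.
  move=> x1; apply/ler_addgt0Pr => e e0.
  have k1 : 0 < kappa + 1 by rewrite ltr_wpDl.
  have [|t1 [b hb xb]] := @gauge_all_lt x (1 + e / (kappa + 1)).
    by apply: le_lt_trans x1 _; rewrite ltrDl divr_gt0.
  set t := 1 + _ in t1 xb.
  have t1' : emb t != 0 by rewrite lt0r_neq0 // emb_gt0.
  have -> : x = emb t *: (b + (emb t)^-1 *: (x - emb t *: b)).
    by rewrite scalerDr scalerA mulfV // scale1r addrC subrK.
  rewrite SZ (seminormZ sNk) ?(ltW t1) //.
  apply: le_trans (_ : t * kappa <= _).
    rewrite ler_wpM2l ?(ltW t1) // hull_kappa // -fmorphV rnormZ rnorm_emb.
      by rewrite ler_pdivrMl.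
    by rewrite invr_ge0 ltW.
  rewrite /t mulrDl mul1r lerD2l mulrAC ler_pdivrMr // ler_wpM2l ?(ltW e0) //.
  by rewrite lerDl.
have u_kappa : Nk u <= kappa.
  apply/ler_addgt0Pr => e e0; have [|x x1 ux] := uS (e * r); first exact: mulr_gt0.
  apply: le_trans (seminorm_dist sNk u (S x)) _; apply: lerD; first exact: ball_kappa.
  apply: le_trans (NkN _) _; apply: le_trans (gauge_sum_le _) _.
  by rewrite ler_pdivrMl // mulrC ltW.
(* Adding the dropped term to [u_kappa] bounds [gauge_sum u] by [sigma - dyadic k * theta]. *)
have : 0 < dyadic k * theta by exact: mulr_gt0.
move: usigma u_kappa; rewrite NE /kappa mulrDr; lra.
Qed.

(** Hides the hulls and gauges: only equivalence of the norms and the obstruction to quasi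
    attainment remain. *)
Lemma renorming : exists q N : X -> R, exists c eta : R,
  [/\ seminorm q /\ seminorm N, 0 < c /\ 0 < eta,
    forall x, rnorm x <= c * q x /\ q x <= c * rnorm x,
    forall x, rnorm x <= c * N x /\ N x <= c * rnorm x &
    forall (S : X -> X) (u : X) (sigma : R),
      (forall x y, S (x + y) = S x + S y) -> (forall (k : K) x, S (k *: x) = k *: S x) ->
      (forall x, N (S x - x) <= eta * q x) ->
      (forall x, N (S x) <= sigma * q x) ->
      (forall e, 0 < e -> exists2 x, q x <= 1 & rnorm (u - S x) < e) ->
      N u <> sigma].
Proof.
have Mr := Mr_gt0.
have r1 : 0 < r^-1 by rewrite invr_gt0.
have theta_gt0 : 0 < theta by rewrite divr_gt0 // mulr_gt0.
have q0 x := seminorm_ge0 gauge_all_seminorm x.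
have N0 x := seminorm_ge0 gauge_sum_seminorm x.
have c2 : r^-1 <= 2 * (M + r) + r^-1 by rewrite lerDr; lra.
(* The first constant dominates those of all four comparisons; [eta] is [theta * r] divided by the
   constant of [rnorm_gauge_sum]. *)
exists gauge_all, gauge_sum, (2 * (M + r) + r^-1), (theta * r / (2 * (M + r))).
split.
- by split; [exact: gauge_all_seminorm|exact: gauge_sum_seminorm].
- by split; [lra|rewrite divr_gt0 // mulr_gt0].
- move=> x; split.
    apply: le_trans (rnorm_gauge_all x) _; rewrite ler_wpM2r //; lra.
  by apply: le_trans (gauge_all_le x) _; rewrite ler_wpM2r // rnorm_ge0.
- move=> x; split.
    apply: le_trans (rnorm_gauge_sum x) _; rewrite ler_wpM2r //; lra.
  by apply: le_trans (gauge_sum_le x) _; rewrite ler_wpM2r // rnorm_ge0.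
move=> S u sigma SD SZ nearS Ssigma uS /(not_quasi_attained SD SZ _ Ssigma uS); apply.
move=> x; apply: le_trans (rnorm_gauge_sum _) _.
by rewrite -ler_pdivlMl ?mulr_gt0 // mulrA [_ * (theta * r)]mulrC.
Qed.

End Renorming.

End Convexity.
End RealScalars.


Lemma dilation_continuous (K : numFieldType) (V W : normedModType K) (f : V -> W) (c : K) :
  0 < c -> (forall x y, `|f x - f y| <= c * `|x - y|) -> continuous f.
Proof.
move=> c0 fc x; apply/cvgrPdist_lt => e e0.
near=> y; apply: le_lt_trans (fc _ _) _; rewrite mulrC -ltr_pdivlMr //.
by near: y; apply: cvgr_dist_lt; rewrite ?divr_gt0.
Unshelve. all: by end_near. Qed.

(** * Renormed spaces *)

Record equivalent_norm (K : numFieldType) (X : normedModType K) := EquivalentNorm {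
  eqnorm : X -> K;
  eqnormD : forall x y, eqnorm (x + y) <= eqnorm x + eqnorm y;
  eqnormZ : forall (k : K) x, eqnorm (k *: x) = `|k| * eqnorm x;
  eqnorm_equiv : exists2 c : K, 0 < c &
    forall x, `|x| <= c * eqnorm x /\ eqnorm x <= c * `|x| }.

Lemma eqnorm0_eq0 (K : numFieldType) (X : normedModType K) (N : equivalent_norm X) x :
  eqnorm N x = 0 -> x = 0.
Proof.
move=> x0; case: (eqnorm_equiv N) => c _ /(_ x)[+ _]; rewrite x0 mulr0 => h.
by apply/eqP; rewrite -normr_le0.
Qed.

(** A copy of the carrier that depends on [N], so that a second normed structure can be attached to
    it. *)
Definition renormed (K : numFieldType) (X : normedModType K)
  (N : equivalent_norm X) : Type := X.

Section Renormed.
Variables (K : numFieldType) (X : completeNormedModType K) (N : equivalent_norm X).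

HB.instance Definition _ := GRing.Lmodule.copy (renormed N) X.
HB.instance Definition _ := @Lmodule_isNormed.Build K (renormed N) (eqnorm N)
  (eqnormD N) (eqnormZ N) (@eqnorm0_eq0 K X N).

Lemma renormed_norm (x : renormed N) : `|x| = eqnorm N x.
Proof. by []. Qed.

Lemma renormed_complete (F : set_system (renormed N)) : ProperFilter F -> cauchy F -> cvg F.
Proof.
move=> FF /cauchyP Fc; have [c c0 cN] := eqnorm_equiv N.
have FX : cauchy (F : set_system X).
  apply/cauchyP => e e0; have [|x Fx] := Fc (e / c); first by rewrite divr_gt0.
  exists x; apply: filterS Fx => y; rewrite -!ball_normE /= renormed_norm.
  by rewrite ltr_pdivlMr // mulrC; apply: le_lt_trans; case: (cN (x - y)).
have /cvg_ex[x Fx] := @cauchy_cvg X F FF FX.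
apply/cvg_ex; exists x; apply/fcvg_ballP => e e0.
have ec0 : 0 < e / c by rewrite divr_gt0.
apply: filterS (@fcvg_ball _ X F _ x Fx _ ec0) => y; rewrite -!ball_normE /= renormed_norm.
by rewrite ltr_pdivlMr // mulrC; apply: le_lt_trans; case: (cN (x - y)).
Qed.

HB.instance Definition _ := Uniform_isComplete.Build (renormed N) renormed_complete.

End Renormed.

Section RenormedMaps.
Variables (K : numFieldType) (X : completeNormedModType K) (N N' : equivalent_norm X).

Definition unrenorm (x : renormed N) : X := x.
HB.instance Definition _ := GRing.isLinear.Build K (renormed N) X *:%R unrenorm
  (fun _ _ _ => erefl).

(** The identity between two renormings, which will be the operator without quasi norm attaining
    approximations. *)
Definition rerenorm (x : renormed N) : renormed N' := x.
HB.instance Definition _ := GRing.isLinear.Build K (renormed N) (renormed N') *:%R rerenorm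
  (fun _ _ _ => erefl).

Lemma renormed_isomorphic : isomorphic (renormed N) X.
Proof.
have [c c0 cN] := eqnorm_equiv N.
exists unrenorm, (id : X -> renormed N); split=> //.
  by apply: (dilation_continuous c0) => x y; case: (cN (x - y)).
by apply: (dilation_continuous c0) => x y; case: (cN (x - y)).
Qed.

End RenormedMaps.

Lemma bounded_operatorsP (K : numFieldType) (V W : normedModType K) (T : {linear V -> W}) :
  bounded_operators V W T <-> exists c, forall x, `|x| <= 1 -> `|T x| <= c.
Proof.
have ball0 : unit_ball V 0 by rewrite /unit_ball /= normr0.
split=> [|[c Tc]].
  by move=> /(@ex_bound _ _ _ _ _ (globally_properfilter ball0))[M TM]; exists M.
by apply/(@ex_bound _ _ _ _ _ (globally_properfilter ball0)); exists c => x; exact: Tc.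
Qed.

(** The least upper bound is a hypothesis because its existence depends on the field. *)
Lemma opnorm_bound (K : numFieldType) (V W : normedModType K) (T : {linear V -> W}) :
  isLub [set `|T x| | x in unit_ball V] (opnorm T) ->
  forall x, `|T x| <= opnorm T * `|x|.
Proof.
move=> [ubT _] x; have [->|x0] := eqVneq x 0; first by rewrite linear0 !normr0 mulr0.
have xV : `| `|x|^-1 | = `|x|^-1 by rewrite normfV normr_id.
rewrite -ler_pdivrMr ?normr_gt0 // mulrC -xV -normrZ -linearZ.
by apply: ubT; exists (`|x|^-1 *: x) => //; rewrite /unit_ball /= normfZV.
Qed.

(** * Failure of density, for both scalar fields at once *)

Section NonDensity.
Context (R : realType) (K : numFieldType) (emb : {rmorphism R -> K}) (re : K -> R).
Hypothesis emb_le : {mono emb : x y / x <= y}.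
Hypothesis reK : forall z, 0 <= z -> emb (re z) = z.
Hypothesis disc_nets : forall e : R, 0 < e -> exists s : seq K,
  forall k : K, `|k| <= 1 -> exists2 l, l \in s & `|k - l| <= emb e.
Hypothesis opnorm_lub : forall (V W : normedModType K) (T : {linear V -> W}),
  bounded_operators V W T ->
  isLub [set `|T x| | x in unit_ball V] (opnorm T).

Local Notation rnorm := (rnorm re).

Lemma seminorm_equivalent (X : normedModType K) (p : X -> R) (c : R) :
  seminorm re p -> 0 < c ->
  (forall x, rnorm x <= c * p x /\ p x <= c * rnorm x) ->
  exists N : equivalent_norm X, forall x, eqnorm N x = emb (p x).
Proof.
move=> [pD pZ] c0 pc.
have D x y : emb (p (x + y)) <= emb (p x) + emb (p y) by rewrite -rmorphD emb_le.
have Z (k : K) x : emb (p (k *: x)) = `|k| * emb (p x).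
  by rewrite pZ rmorphM /= (embn reK).
have equiv : exists2 d : K, 0 < d &
    forall x, `|x| <= d * emb (p x) /\ emb (p x) <= d * `|x|.
  exists (emb c); first by rewrite emb_gt0.
  by move=> x; rewrite -(embn reK) -!rmorphM !emb_le.
by exists (EquivalentNorm D Z equiv).
Qed.

Lemma not_radon_nikodym (X : normedModType K) : ~ radon_nikodym X ->
  exists (a : nat -> X) (d M : R), [/\ 0 < d, forall n, rnorm (a n) <= M &
    forall x, range a x ->
      closure (convex_hull (range a `\` [set b | rnorm (b - x) < d])) x].
Proof.
move=> /existsNP[A /not_implyP[A0 /not_implyP[bA /existsNP[d /not_implyP[d0 ndA]]]]].
have [x Ax] := A0.
have [M AM] : exists M, forall y, A y -> `|y| <= M.
  by move/(@ex_bound _ _ _ _ _ (globally_properfilter Ax)): bA => -[M]; exists M.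
have M0 : 0 <= M by apply: le_trans (AM _ Ax).
have clA a : A a ->
    closure (convex_hull (A `\` [set b | rnorm (b - a) < re d])) a.
  move=> Aa; apply: contrapT => na; apply: ndA; exists a => //.
  rewrite (_ : [set b | `|b - a| < d] = [set b | rnorm (b - a) < re d]) //.
  apply/funext => b /=.
  by rewrite -(emb_lt emb_le) (embn reK) (reK (ltW d0)).
have [a [aA nda]] := nondentable_sequence emb_le reK A0 clA.
exists a, (re d), (re M); split=> // [|n].
  by rewrite -(emb_gt0 emb_le) reK // ltW.
by rewrite -emb_le (embn reK) reK // AM.
Qed.

Theorem QNA_not_dense (X : completeNormedModType K) : ~ radon_nikodym X ->
  exists X1 X2 : completeNormedModType K,
    [/\ isomorphic X1 X, isomorphic X2 X & ~ opnorm_dense (QNA X1 X2)].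
Proof.
move=> /not_radon_nikodym[a [d [M [d0 aM nda]]]].
have [q [N [c [eta [[sq sN] [c0 eta0] qc Nc notQNA]]]]] :=
  renorming emb_le reK disc_nets d0 aM nda.
have [Q QE] := seminorm_equivalent sq c0 qc.
have [P PE] := seminorm_equivalent sN c0 Nc.
exists (renormed Q), (renormed P); split; [exact: renormed_isomorphic|exact: renormed_isomorphic|].
have rQ (x : renormed Q) : rnorm x = q x.
  by apply: (emb_inj emb_le); rewrite (embn reK) renormed_norm QE.
have rP (x : renormed P) : rnorm x = N x.
  by apply: (emb_inj emb_le); rewrite (embn reK) renormed_norm PE.
pose T : {linear renormed Q -> renormed P} := @rerenorm K X Q P.
have bT : bounded_operators (renormed Q) (renormed P) T.
  apply/bounded_operatorsP; exists (emb (c * c)) => x x1.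
  rewrite -(embn reK) emb_le rP; have [_ Nx] := Nc x; apply: le_trans Nx _.
  rewrite ler_pM2l //; have [xq _] := qc x; apply: le_trans xq _.
  rewrite ler_piMr ?(ltW c0) // -rQ -emb_le (embn reK) rmorph1 //.
move=> /(_ T bT (emb eta)); rewrite (emb_gt0 emb_le) => /(_ eta0)[S [bS [u uS uE]] TS].
have lubS := opnorm_lub bS.
have bTS : bounded_operators (renormed Q) (renormed P) (T \- S).
  move/bounded_operatorsP: bT => [m Tm]; move/bounded_operatorsP: bS => [n Sn].
  apply/bounded_operatorsP; exists (m + n) => x x1.
  by apply: le_trans (ler_normB _ _) _; rewrite lerD ?Tm ?Sn.
pose S' : X -> X := S.
(* Here [rnorm u] is both [N u] and the operator norm of [S]. *)
apply: (notQNA S' (u : X) (rnorm u)) => //.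
- exact: (linearD S).
- exact: (linearZZ S).
- move=> x; rewrite (seminormB emb_le reK sN).
  have : rnorm ((T \- S) x) <= eta * rnorm (x : renormed Q).
    rewrite -emb_le rmorphM /= !(embn reK).
    apply: le_trans (opnorm_bound (opnorm_lub bTS) _) _.
    by rewrite ler_wpM2r // ltW.
  by rewrite rP rQ.
- move=> x; have : rnorm (S x) <= rnorm u * rnorm (x : renormed Q).
    by rewrite -emb_le rmorphM /= !(embn reK) uE opnorm_bound.
  by rewrite rP rQ.
(* The closure is taken for [N]; dividing by [c] converts it to the original norm. *)
- move=> e e0; move/(closure_rnorm emb_le reK): uS => /(_ (e / c)) [].
    by rewrite divr_gt0.
  move=> _ [x x1 <-]; rewrite rP ltr_pdivlMr // mulrC => ux; exists x.
    by rewrite -rQ -emb_le (embn reK) rmorph1.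
  by apply: le_lt_trans ux; case: (Nc (u - S' x)).
Qed.

End NonDensity.

(** * Finite nets in the unit balls of the scalar fields *)

Lemma interval_nets (R : realType) (e : R) : 0 < e -> exists s : seq R,
  forall k, `|k| <= 1 -> exists2 l, l \in s & `|k - l| <= e.
Proof.
move=> e0; pose n := Num.bound e^-1.
have ne : e^-1 < n%:R by apply: archi_boundP; rewrite invr_ge0 ltW.
have n0 : 0 < n%:R :> R by apply: lt_trans ne; rewrite invr_gt0.
(* The grid of mesh [1 / n] from -1 to 1; its last index [n + n] is reached at [k = 1]. *)
exists [seq j%:R / n%:R - 1 | j <- iota 0 (n + n).+1] => k.
rewrite ler_norml => /andP[k0 k1].
have kn : 0 <= (k + 1) * n%:R by apply: mulr_ge0; [lra|exact: ltW].
have /andP[jk kj] := truncn_itv kn.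
set j := Num.truncn _ in jk kj.
exists (j%:R / n%:R - 1).
  apply/mapP; exists j => //; rewrite mem_iota /= add0n ltnS.
  rewrite -(ler_nat R); apply: le_trans jk _.
  by rewrite natrD -mulr2n -[leRHS]mulr_natl ler_pM2r //; lra.
rewrite ler_norml; have ne' : n%:R^-1 <= e.
  by rewrite invf_ple ?posrE // ltW.
have h1 : j%:R / n%:R <= k + 1 by rewrite ler_pdivrMr.
have h2 : k + 1 < j%:R / n%:R + n%:R^-1.
  have -> : j%:R / n%:R + n%:R^-1 = j.+1%:R / n%:R :> R.
    by rewrite -natr1 mulrDl mul1r.
  by rewrite ltr_pdivlMr.
by apply/andP; split; lra.
Qed.

(** A product grid with error [e / 2] in each coordinate has error at most [e]; its points may lie
    outside the disc. *)
Lemma complex_disc_nets (R : realType) (e : R) : 0 < e -> exists s : seq R[i],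
  forall k : R[i], `|k| <= 1 -> exists2 l, l \in s & `|k - l| <= e%:C.
Proof.
move=> e0; have [|s sP] := @interval_nets R (e / 2); first by rewrite divr_gt0.
exists [seq Complex x y | x <- s, y <- s] => -[x y] k1.
have normE (a b : R) : `|Complex a b| = (Num.sqrt (a ^+ 2 + b ^+ 2))%:C.
  by rewrite normc_def.
have le_sqrt (a b : R) : `|a| <= Num.sqrt (a ^+ 2 + b ^+ 2).
  by rewrite -sqrtr_sqr ler_wsqrtr // lerDl sqr_ge0.
move: k1; rewrite normE lecR => k1.
have [x' x's xx'] := sP x (le_trans (le_sqrt x y) k1).
have [y' y's yy'] : exists2 l, l \in s & `|y - l| <= e / 2.
  by apply: sP; apply: le_trans k1; rewrite addrC.
exists (Complex x' y'); first exact: allpairs_f.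
rewrite (_ : _ - _ = Complex (x - x') (y - y')) // normE lecR.
rewrite -[leRHS]ger0_norm ?(ltW e0) // -sqrtr_sqr ler_wsqrtr //.
have sq (a : R) : `|a| <= e / 2 -> a ^+ 2 <= (e / 2) ^+ 2.
  by move=> ae; rewrite -[a ^+ 2]real_normK ?num_real // lerXn2r ?nnegrE // divr_ge0 // ltW.
apply: le_trans (lerD (sq _ xx') (sq _ yy')) _.
have := sqr_ge0 e; rewrite !expr2; lra.
Qed.

Theorem proposition2p9 (R : realType) :
  (forall X : completeNormedModType R, ~ radon_nikodym X ->
     exists X1 X2 : completeNormedModType R,
       [/\ isomorphic X1 X, isomorphic X2 X & ~ opnorm_dense (QNA X1 X2)]) /\
  (forall X : completeNormedModType R[i], ~ radon_nikodym X ->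
     exists X1 X2 : completeNormedModType R[i],
       [/\ isomorphic X1 X, isomorphic X2 X & ~ opnorm_dense (QNA X1 X2)]).
Proof.
split=> X; first apply: (@QNA_not_dense R R idfun id) => //.
- by move=> e /interval_nets.
- exact: opnorm_lub_real.
apply: (@QNA_not_dense R R[i] (real_complex R) (@complex.Re R)).
- by move=> x y; rewrite lecR.
- by move=> [x y]; rewrite lecE /= => /andP[/eqP->].
- by move=> e /complex_disc_nets.
- exact: opnorm_lub_complex.
Qed.
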